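(* There is no edge-girth-regular graph with parameters $(v,4,4,4)$; that is, for every positive integer $v$, no $egr(v,4,4,4)$-graph exists.
   Context: Graphs are finite, simple and undirected. For integers $v,k,g,\lambda$, an $egr(v,k,g,\lambda)$-graph (edge-girth-regular graph) is a $k$-regular graph on $v$ vertices with girth $g$ (the length of a shortest cycle is exactly $g$) such that every edge is contained in exactly $\lambda$ cycles of length $g$. *)

(* Defs.v *)
From mathcomp Require Import all_boot.
Set Implicit Arguments.
Unset Strict Implicit.
Unset Printing Implicit Defensive.

Record sgraph := SGraph {
  vertex :> finType;
  adj : rel vertex;
  adj_sym : symmetric adj;
  adj_irrefl : irreflexive adj }.

Definition edges (G : sgraph) : {set {set G}} :=
  [set [set p.1; p.2] | p : G * G & adj p.1 p.2].

Definition regular (G : sgraph) (k : nat) : Prop :=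
  forall x : G, #|[set y | adj x y]| = k.

(* [c] lists the vertices of a cycle in cyclic order. Without the length bound,
   [ucycleb] would accept [::] and, by symmetry of [adj], any [:: x; y] with
   [adj x y]. *)
Definition is_cycle (G : sgraph) (c : seq G) : bool :=
  (3 <= size c) && ucycleb (@adj G) c.

Definition cycle_edges (G : sgraph) (c : seq G) : {set {set G}} :=
  [set [set x; next c x] | x in c].

(* A cycle is counted as a subgraph, identified with its edge set, so that the
   [2 * g] vertex lists obtained by rotating and reversing a list of length [g]
   count once. *)
Definition cycles_of_length (G : sgraph) (g : nat) : {set {set {set G}}} :=
  [set cycle_edges c | c : g.-tuple G & is_cycle c].

Definition has_girth (G : sgraph) (g : nat) : Prop :=
  (exists c : seq G, is_cycle c /\ size c = g) /\
  (forall c : seq G, is_cycle c -> g <= size c).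

Definition egr (v k g lambda : nat) (G : sgraph) : Prop :=
  [/\ #|G| = v,
      regular G k,
      has_girth G g
    & forall f : {set G}, f \in edges G ->
        #|[set C in cycles_of_length G g | f \in C]| = lambda].

(* Main.v *)
(** Write [codeg x z] for the number of common neighbours of [x] and [z]. The
    4-cycles through an edge [xy] correspond to the pairs [(z, u)] with
    [z] in [N(y) \ x] and [u] in [N(x)] and [N(z)] but [u <> y]; hence the
    codegrees of [x] with the three other neighbours of [y] add up to 7. On the
    four points of [N(y)], this makes the codegrees of opposite pairs equal, and
    so excludes the codegrees 4 and 1. Thus for every [y] in [N(x)] exactly one
    of the three others has codegree 3 with [x] (as 7 = 3 + 2 + 2), and the four
    points of [N(x)] are partitioned into triples, which is absurd. *)
Require Import Defs.
From mathcomp Require Import all_boot zify.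

Set Implicit Arguments.
Unset Strict Implicit.
Unset Printing Implicit Defensive.

Lemma set2_eq (T : finType) (a b c d : T) :
  [set a; b] = [set c; d] -> a = c /\ b = d \/ a = d /\ b = c.
Proof.
move=> E.
have /set2P[ac|ad] : a \in [set c; d] by rewrite -E set21.
  have /set2P[bc|bd] : b \in [set c; d] by rewrite -E set22.
    have /set2P[da|db] : d \in [set a; b] by rewrite E set22.
      by left; rewrite ac bc da ac.
    by left; rewrite ac db.
  by left.
have /set2P[bc|bd] : b \in [set c; d] by rewrite -E set22.
  by right.
have /set2P[ca|cb] : c \in [set a; b] by rewrite E set21.
  by right; rewrite ad bd ca ad.
by right; rewrite ad cb.
Qed.

(** * Codegrees, and 4-cycles as sets of edges *)

Section Graph.
Variable G : sgraph.
Implicit Types x y z u p q : G.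

Definition nbhd x : {set G} := [set y | adj x y].
Definition codeg x z := #|nbhd x :&: nbhd z|.

Lemma in_nbhd x y : (y \in nbhd x) = adj x y.
Proof. by rewrite inE. Qed.

Lemma codegC x z : codeg x z = codeg z x.
Proof. by rewrite /codeg setIC. Qed.

Lemma adj_neq x y : adj x y -> x != y.
Proof. by apply: contraTneq => ->; rewrite adj_irrefl. Qed.

Definition quad x y z u : {set {set G}} :=
  [set [set x; y]; [set y; z]; [set z; u]; [set u; x]].

Lemma quad_rot x y z u : quad x y z u = quad y z u x.
Proof.
by apply/setP => e; rewrite !inE; do 4 case: (_ == _).
Qed.

Lemma quad_rev x y z u : quad x y z u = quad y x u z.
Proof.
apply/setP => e; rewrite !inE [[set y; x]]setUC [[set x; u]]setUC.
by rewrite [[set u; z]]setUC [[set z; y]]setUC; do 4 case: (_ == _).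
Qed.

Lemma cycle_edges4 x y z u :
  uniq [:: x; y; z; u] -> cycle_edges [:: x; y; z; u] = quad x y z u.
Proof.
rewrite /= !inE !negb_or andbT => /and3P[/and3P[xy xz xu] /andP[yz yu] zu].
have next_x : next [:: x; y; z; u] x = y by rewrite /= eqxx.
have next_y : next [:: x; y; z; u] y = z.
  by rewrite /= eq_sym (negbTE xy) eqxx.
have next_z : next [:: x; y; z; u] z = u.
  by rewrite /= eq_sym (negbTE xz) eq_sym (negbTE yz) eqxx.
have next_u : next [:: x; y; z; u] u = x.
  rewrite /= eq_sym (negbTE xu) eq_sym (negbTE yu).
  by rewrite eq_sym (negbTE zu) eqxx.
apply/setP => e; apply/imsetP/idP => [[t]|].
  rewrite !inE => /or4P[]/eqP-> ->.
  - by rewrite next_x eqxx.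
  - by rewrite next_y eqxx orbT.
  - by rewrite next_z eqxx !orbT.
  - by rewrite next_u eqxx !orbT.
rewrite !inE -!orbA => /or4P[]/eqP->.
- by exists x; rewrite ?inE ?eqxx ?next_x.
- by exists y; rewrite ?inE ?eqxx ?orbT ?next_y.
- by exists z; rewrite ?inE ?eqxx ?orbT ?next_z.
- by exists u; rewrite ?inE ?eqxx ?orbT ?next_u.
Qed.

(** * Counting the 4-cycles through an edge *)

Definition quad_completions x y : {set G * G} :=
  [set p : G * G | [&& p.1 \in nbhd y :\ x & p.2 \in (nbhd x :&: nbhd p.1) :\ y]].

Lemma quad_completionsP x y z u : adj x y ->
  ((z, u) \in quad_completions x y) = is_cycle [:: x; y; z; u].
Proof.
move=> xy; rewrite /is_cycle /ucycleb !inE /= !inE xy !negb_or !andbT.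
rewrite (adj_neq xy) [adj u x]adj_sym [z == x]eq_sym [u == y]eq_sym.
apply/idP/idP.
  case/andP => /andP[-> yz] /and3P[-> xu zu].
  by rewrite xu yz zu (adj_neq yz) (adj_neq xu) (adj_neq zu).
case/andP => /and4P[_ yz zu xu] /and3P[/and3P[_ xz _] /andP[_ yu] _].
by rewrite yz zu xu xz yu.
Qed.

(** Only two edges of the cycle meet [y], namely [xy] and [yz]. *)
Lemma quad_fst x y z u t : is_cycle [:: x; y; z; u] -> t != x ->
  [set y; t] \in quad x y z u -> t = z.
Proof.
case/and3P => _ _ /=; rewrite !inE !negb_or !andbT.
case/and3P => /and3P[xy xz xu] /andP[yz yu] zu tx.
rewrite -!orbA => /or4P[]/eqP/set2_eq[][yE tE] //.
- by rewrite yE eqxx in xy.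
- by rewrite tE eqxx in tx.
- by rewrite yE eqxx in yz.
- by rewrite yE eqxx in yz.
- by rewrite yE eqxx in yu.
- by rewrite yE eqxx in xy.
Qed.

Lemma is_cycle4_rev x y z u :
  is_cycle [:: x; y; z; u] -> is_cycle [:: y; x; u; z].
Proof.
rewrite /is_cycle /ucycleb /= !inE !negb_or !andbT.
case/andP => /and4P[xy yz zu ux] /and3P[/and3P[nxy nxz nxu] /andP[nyz nyu] nzu].
rewrite adj_sym xy adj_sym ux adj_sym zu adj_sym yz.
by rewrite eq_sym nxy nyu nyz nxu nxz eq_sym nzu.
Qed.

Lemma is_cycle4_rot x y z u :
  is_cycle [:: x; y; z; u] -> is_cycle [:: y; z; u; x].
Proof.
case/andP => _ cyc; apply/andP; split=> //.
by rewrite /ucycleb -[[:: y; _; _; _]]/(rot 1 [:: x; y; z; u]) rot_cycle rot_uniq.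
Qed.

(** The edge set determines [z] as the neighbour of [y] on the cycle other than [x]. Reversing the
    cycle swaps the roles of [x] and [y], so [u] is determined in the same way. *)
Lemma quad_inj x y : adj x y ->
  {in quad_completions x y &, injective (fun p : G * G => quad x y p.1 p.2)}.
Proof.
move=> xy [z u] [z' u'] /=; rewrite !quad_completionsP // => c c' E.
have neqs z0 u0 : is_cycle [:: x; y; z0; u0] -> z0 != x /\ u0 != y.
  case/and3P => _ _ /=; rewrite !inE !negb_or [z0 == x]eq_sym [u0 == y]eq_sym.
  by case/and4P => /and3P[_ -> _] /andP[_ ->].
have [z'x u'y] := neqs _ _ c'.
congr pair; apply/esym.
  by apply: (quad_fst c) => //; rewrite E !inE eqxx orbT.
apply: (quad_fst (is_cycle4_rev c)) => //.
by rewrite -quad_rev E quad_rev !inE eqxx orbT.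
Qed.

(** A 4-cycle containing the edge [xy] can be rotated until this edge comes first, then reversed if
    it is traversed from [y] to [x]. *)
Lemma quad_imset x y : adj x y ->
  [set C in cycles_of_length G 4 | [set x; y] \in C] =
  [set quad x y p.1 p.2 | p in quad_completions x y].
Proof.
move=> xy; apply/setP => C; rewrite inE; apply/andP/imsetP; last first.
  case=> -[z u]; rewrite quad_completionsP //= => c ->.
  split; last by rewrite !inE eqxx.
  apply/imsetP; exists [tuple x; y; z; u]; first by rewrite inE.
  by rewrite cycle_edges4 //; case/and3P: c.
case=> /imsetP[[c size_c]]; rewrite inE /= => cyc -> {C}.
move: c size_c cyc => [|a [|b [|d [|e []]]]] // _ cyc.
rewrite cycle_edges4; last by case/and3P: cyc.
have main a' b' d' e' : is_cycle [:: a'; b'; d'; e'] ->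
    quad a' b' d' e' = quad a b d e -> [set x; y] = [set a'; b'] ->
    exists2 p, p \in quad_completions x y & quad a b d e = quad x y p.1 p.2.
  move=> cyc' <- /set2_eq[][xE yE]; subst a' b'.
    by exists (d', e'); rewrite ?quad_completionsP.
  exists (e', d'); last by rewrite quad_rev.
  by rewrite quad_completionsP //; apply: is_cycle4_rev.
have cyc1 := is_cycle4_rot cyc.
have cyc2 := is_cycle4_rot cyc1.
have cyc3 := is_cycle4_rot cyc2.
rewrite {1}/quad !inE -!orbA => /or4P[]/eqP E.
- by apply: main cyc _ E.
- by apply: main cyc1 _ E; rewrite (quad_rot a).
- by apply: main cyc2 _ E; rewrite (quad_rot a) (quad_rot b).
- by apply: main cyc3 _ E; rewrite (quad_rot e).
Qed.

(** The pairs are summed over [z] first. The predecessor accounts for [y], which is a common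
    neighbour of [x] and [z] but is excluded as a value of [u]. *)
Lemma card_quad_completions x y : adj x y ->
  #|quad_completions x y| = \sum_(z in nbhd y :\ x) (codeg x z).-1.
Proof.
move=> xy; rewrite -sum1_card /=.
rewrite (eq_bigl (fun p : G * G => (p.1 \in nbhd y :\ x) &&
    (p.2 \in (nbhd x :&: nbhd p.1) :\ y))); last by move=> p; rewrite inE.
rewrite -(pair_big_dep (mem (nbhd y :\ x))
    (fun z u => u \in (nbhd x :&: nbhd z) :\ y) (fun _ _ => 1)) /=.
apply: eq_bigr => z; rewrite in_setD1 in_nbhd => /andP[_ yz].
rewrite sum1_card /codeg (cardsD1 y (nbhd x :&: nbhd z)).
by rewrite in_setI !in_nbhd xy adj_sym yz.
Qed.

(** * Codegrees in a 4-regular graph with four 4-cycles through each edge *)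

Hypothesis reg : regular G 4.
Hypothesis edge4 : forall f : {set G}, f \in edges G ->
  #|[set C in cycles_of_length G 4 | f \in C]| = 4.

Lemma card_nbhd x : #|nbhd x| = 4.
Proof. exact: reg. Qed.

Lemma codeg_le4 x z : codeg x z <= 4.
Proof. by rewrite -(card_nbhd x) subset_leq_card ?subsetIl. Qed.

Lemma codeg_gt0 x y z : adj y x -> adj y z -> 0 < codeg x z.
Proof.
move=> yx yz; apply/card_gt0P; exists y.
by rewrite in_setI !in_nbhd adj_sym yx adj_sym.
Qed.

(** Here 7 = 4 + 3: the four cycles through [xy] are the sum of the predecessors, and each of the
    three vertices [z] gives back one, its codegree with [x] being positive. *)
Lemma sum_codeg x y : adj x y ->
  \sum_(z in nbhd y :\ x) codeg x z = 7.
Proof.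
move=> xy.
have exy : [set x; y] \in edges G.
  by apply/imsetP; exists (x, y); rewrite ?inE.
have := edge4 exy; rewrite quad_imset // card_in_imset; last exact: quad_inj.
rewrite card_quad_completions // => E.
have : \sum_(z in nbhd y :\ x) ((codeg x z).-1 + 1) =
    \sum_(z in nbhd y :\ x) codeg x z.
  apply: eq_bigr => z; rewrite in_setD1 in_nbhd => /andP[_ yz].
  by rewrite addn1 prednK // (@codeg_gt0 _ y) // adj_sym.
rewrite big_split /= E sum1_card => <-.
by have := cardsD1 x (nbhd y); rewrite card_nbhd in_nbhd adj_sym xy add1n => -[<-].
Qed.

(** Codegrees weight the six pairs of points of [nbhd y], with total 7 at each point. Adding the
    totals at two points and subtracting those at the other two leaves twice the difference of two
    opposite weights. *)
Lemma nbhd_codeg x y z : adj y x -> adj y z -> x != z ->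
  exists p q, [/\ codeg x z + codeg x p + codeg x q = 7,
    codeg z p = codeg x q, codeg z q = codeg x p & codeg p q = codeg x z].
Proof.
move=> yx yz xz.
have : #|nbhd y :\ x :\ z| == 2.
  have := cardsD1 x (nbhd y); rewrite card_nbhd in_nbhd yx add1n => -[E].
  by have := cardsD1 z (nbhd y :\ x); rewrite -E !inE eq_sym xz yz add1n => -[<-].
case/cards2P => p [q [pq E]].
have /setD1P[pz /setD1P[px]] : p \in nbhd y :\ x :\ z by rewrite E set21.
have /setD1P[qz /setD1P[qx]] : q \in nbhd y :\ x :\ z by rewrite E set22.
rewrite !in_nbhd => yq yp; exists p, q.
have uniq_xzpq : uniq [:: x; z; p; q].
  by rewrite /= !inE !negb_or xz pq !(eq_sym x) !(eq_sym z) px qx pz qz.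
have nbE : nbhd y =i [:: x; z; p; q].
  move=> t; have /setP/(_ t) := E; rewrite !inE.
  have [->|_] := eqVneq t x; first by rewrite yx.
  by have [->|_] := eqVneq t z; first by rewrite yz.
(* Any of the four points may play the role of [x], so the total is proved once for every
   ordering. *)
have sum_from a b c d : perm_eq [:: a; b; c; d] [:: x; z; p; q] ->
    codeg a b + codeg a c + codeg a d = 7.
  move=> abcd; have yE t : (t \in nbhd y) = (t \in [:: a; b; c; d]).
    by rewrite nbE (perm_mem abcd).
  have /andP[a_bcd uniq_bcd] : uniq [:: a; b; c; d] by rewrite (perm_uniq abcd).
  have ya : adj a y by rewrite adj_sym -in_nbhd yE mem_head.
  rewrite -(sum_codeg ya) (eq_bigl [in [:: b; c; d]]).
    by rewrite -big_uniq //= !big_cons big_nil addn0 addnA.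
  move=> t; rewrite in_setD1 yE [in LHS]in_cons.
  by have [->|//] := eqVneq t a; rewrite [RHS](negbTE a_bcd).
have sum_x := sum_from x z p q (perm_refl _).
have sum_z : codeg z x + codeg z p + codeg z q = 7.
  (* Permuted lists are compared by counting an arbitrary predicate, which is settled by its four
     truth values. *)
  apply: sum_from; apply/permP => P /=.
  by move: (P x) (P z) (P p) (P q) => [] [] [] [].
have sum_p : codeg p x + codeg p z + codeg p q = 7.
  apply: sum_from; apply/permP => P /=.
  by move: (P x) (P z) (P p) (P q) => [] [] [] [].
have sum_q : codeg q x + codeg q z + codeg q p = 7.
  apply: sum_from; apply/permP => P /=.
  by move: (P x) (P z) (P p) (P q) => [] [] [] [].
move: sum_x sum_z sum_p sum_q; rewrite (codegC z x) (codegC p x) (codegC p z).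
rewrite (codegC q x) (codegC q z) (codegC q p); clear.
move: (codeg x z) (codeg x p) (codeg x q) (codeg z p) (codeg z q) (codeg p q).
by move=> *; split; lia.
Qed.

(** Codegree 4 forces [nbhd x = nbhd z], so [x] has equal codegrees with [p] and [q]; these would
    add up to 3, which is odd. *)
Lemma codeg_lt4 x y z : adj y x -> adj y z -> x != z -> codeg x z < 4.
Proof.
move=> yx yz xz; rewrite ltn_neqAle codeg_le4 andbT.
apply/negP => /eqP xz4.
have nE : nbhd x = nbhd z.
  have sub a b : codeg a b = 4 -> nbhd a \subset nbhd b.
    move=> ab4; apply/setIidPl/eqP.
    by rewrite eqEcard subsetIl card_nbhd -/(codeg a b) ab4.
  by apply/eqP; rewrite eqEsubset !sub // codegC.
have [p [q]] := nbhd_codeg yx yz xz.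
rewrite xz4 /codeg -nE => -[]; lia.
Qed.

(** Inclusion-exclusion inside the four points of [nbhd x]. *)
Lemma codeg_overlap x p q : codeg x p + codeg x q <= 4 + codeg p q.
Proof.
rewrite /codeg -(cardsUI (nbhd x :&: nbhd p)) leq_add //.
  by rewrite -(card_nbhd x) subset_leq_card // subUset !subsetIl.
rewrite subset_leq_card //.
by apply/subsetP => t; rewrite !inE => /andP[/andP[_ ->] /andP[_ ->]].
Qed.

(** If [codeg x z] were at most 1, the other two codegrees of [x] would add up to at least 6, while
    the overlap bound allows at most 4 + 1, as [codeg p q = codeg x z]. *)
Lemma codeg_gt1 x y z : adj y x -> adj y z -> x != z -> 1 < codeg x z.
Proof.
move=> yx yz xz; have [p [q [sum_x _ _ pq]]] := nbhd_codeg yx yz xz.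
by have := codeg_overlap x p q; lia.
Qed.

(** * Double counting the pairs of codegree 3 *)

Lemma card_codeg3 x y : adj x y ->
  #|[set z in nbhd y :\ x | codeg x z == 3]| = 1.
Proof.
move=> xy; have := sum_codeg xy.
(* Every codegree here is 2 or 3, so it is 2 plus an indicator. *)
rewrite (eq_bigr (fun z => 2 + (codeg x z == 3))); last first.
  move=> z; rewrite in_setD1 in_nbhd => /andP[zx yz].
  have yx : adj y x by rewrite adj_sym.
  have xz : x != z by rewrite eq_sym.
  by have := codeg_lt4 yx yz xz; have := codeg_gt1 yx yz xz; lia.
rewrite big_split /= sum_nat_const -sum1dep_card big_mkcondr /=.
have := cardsD1 x (nbhd y); rewrite card_nbhd in_nbhd adj_sym xy add1n => -[<-].
(* The constant 2 over three vertices makes 6, and 7 = 6 + 1. *)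
exact: (@addnI 6 _ 1).
Qed.

Lemma egr4_vertex_false x : False.
Proof.
have : \sum_(y in nbhd x) \sum_(z in nbhd y :\ x | codeg x z == 3) 1 = 4.
  rewrite -(card_nbhd x) -sum1_card; apply: eq_bigr => y.
  by rewrite in_nbhd sum1dep_card => /card_codeg3.
(* Summed over [z] first, each [z] is met once for each of its three common neighbours [y] with [x],
   so the total 4 would be a multiple of 3. *)
rewrite (exchange_big_dep (fun z => (z != x) && (codeg x z == 3))) /=; last first.
  by move=> y z _; rewrite !inE => /andP[/andP[-> _] ->].
rewrite (eq_bigr (fun=> 3)) ?sum_nat_const; first by lia.
move=> z /andP[zx /eqP xz3].
rewrite sum1dep_card -xz3; apply: eq_card => y.
by rewrite !inE zx xz3 eqxx andbT (adj_sym z).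
Qed.

End Graph.

Theorem theorem1 (v : nat) (v_gt0 : 0 < v) :
  ~ exists G : sgraph, egr v 4 4 4 G.
Proof.
case=> G [cardG reg _ edge4].
have /card_gt0P[x _] : 0 < #|G| by rewrite cardG.
exact: (egr4_vertex_false reg edge4 x).
Qed.
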